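(* For every network of diameter $\Delta$ and every first-order formula $\psi$ containing $w$ variables or constants (counted together), the distributed time complexity of the evaluation of $\psi$ by the query engine $\mathcal{QE}_{FO}$ is at most $2\Delta w$ rounds.
   Context: Networks: $U$ is an infinite linearly ordered set of node identifiers. A network $\mathbf{G}=(V,G)$ is a finite, connected, undirected graph with $V\subset U$ and symmetric edge relation $G$, of degree bounded by a constant $D$; $n=|V|$ and $\Delta$ is the diameter. The model is synchronous message passing. Each node knows its own identifier, its neighbours' identifiers, $n$ and $\Delta$. In each round every node performs local computation and then broadcasts messages to all its neighbours, which receive them. A query is posed by a requesting node. The distributed time is the maximal number of rounds of any node until termination, i.e. until no node has messages left to send. Formulas are first-order over $\{G\}$ with equality and node identifiers as constants. The answer to $\varphi(x_1,\dots,x_\ell)$ is $\{(a_1,\dots,a_\ell): \mathbf{G}\models\varphi(a_1,\dots,a_\ell)\}$, each tuple being stored at node $a_1$. The query engine $\mathcal{QE}_{FO}$ works as follows. - Messages and tables. It uses three kinds of messages: Boolean queries $?B\varphi$ ($\varphi$ a sentence possibly containing constants); partially instantiated queries $?x_1\dots ?x_i\,!a_{i+1}\dots !a_\ell\,\varphi(x_1,\dots,x_i,a_{i+1},\dots,a_\ell)$; and Boolean answers $!B\varphi$ (with a truth value). Each node keeps a query table of pairs (query, parent query) and an answer table. - Local simplification. Every node simplifies each formula it handles by replacing with their truth values all atoms it can decide from its local data. These are the atoms $G(b,c)$ in which $b$ or $c$ is its own identifier, and equalities between constants. - Handling a query. The requesting node issues the query. When a node $a$ issues or receives a query that is not yet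 in its query table, it records the query (with its parent), broadcasts it to its neighbours, and processes it as follows. - If the query still has free variables $x_1,\dots,x_i$, node $a$ instantiates the rightmost one, $x_i$, by its own identifier and handles the resulting subquery in the same way. When all free variables are instantiated (the last one, $x_1$, at node $a_1$), node $a_1$ issues the Boolean query $?B\varphi(a_1,\dots,a_\ell)$ and records it with parent $!a_1\dots!a_\ell\varphi(a_1,\dots,a_\ell)$. - If the query is Boolean of the form $Qx\,\psi$ with $Q\in\{\exists,\forall\}$ the leftmost quantifier, node $a$ instantiates $x$ by its own identifier, obtaining $\psi(a)$. If $\psi(a)$ is true and $Q=\exists$, this is a witness; if $\psi(a)$ is false and $Q=\forall$, this is a counterevidence. If $\psi(a)$ cannot be decided locally, it is recorded with parent $Qx\,\psi$, broadcast, and handled recursively. - Clocks and answers. A node waiting for the answer to a Boolean query sets a clock of $2\Delta w'$ rounds, where $w'$ is the number of variables and constants of that query. If a witness (resp. counterevidence) arrives, $\exists x\psi$ is true (resp. $\forall x\psi$ is false). If none arrives before the clock elapses, $\exists x\psi$ is declared false (resp. $\forall x\psi$ true). Answers are stored and broadcast, each node forwarding a given answer at most once, until they reach the nodes waiting for them; those nodes then evaluate the parent query and store and broadcast its answer. - Storing results. When the Boolean query $?B\varphi(a_1,\dots,a_\ell)$ generated from a fully instantiated query is answered positively, node $a_1$ stores $(a_1,\dots,a_\ell)$ in its answer table.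
   Formalization: As literally described the bound fails; here w' omits identifiers substituted during evaluation, answers stop after Δ hops, a node whose own clock elapses does not broadcast that answer, and w counts one variable per quantifier (bound variables renamed apart). *)

(* Defs.v *)
From HB Require Import structures.
From mathcomp Require Import all_boot all_order.

Set Implicit Arguments.
Unset Strict Implicit.
Unset Printing Implicit Defensive.

(** * Networks *)

Definition infinite_set (U : eqType) : Prop :=
  forall s : seq U, exists u, u \notin s.

(** The graph is simple; [D] bounds the degree. *)
Record network (d : Order.disp_t) (U : orderType d) (D : nat) := Network {
  nodes : seq U;
  edge : rel U;
  nodes_uniq : uniq nodes;
  edge_sym : symmetric edge;
  edge_irr : irreflexive edge;
  edge_nodes : forall a b, edge a b -> a \in nodes;
  net_connected : forall a b, a \in nodes -> b \in nodes ->
    exists2 p, path edge a p & last a p = b;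
  degree_le : forall a, a \in nodes -> size [seq b <- nodes | edge a b] <= D
}.

Section NetworkNotions.
Context (d : Order.disp_t) (U : orderType d) (D : nat) (G : network U D).

Definition neighbours (a : U) : seq U := [seq b <- nodes G | edge G a b].

Definition walk (a b : U) (k : nat) : Prop :=
  exists p, [/\ path (edge G) a p, last a p = b & size p = k].

Definition is_distance (a b : U) (k : nat) : Prop :=
  walk a b k /\ forall k', walk a b k' -> k <= k'.

Definition is_diameter (Delta : nat) : Prop :=
  (forall a b k, a \in nodes G -> b \in nodes G -> is_distance a b k ->
     k <= Delta) /\
  (exists a b, [/\ a \in nodes G, b \in nodes G & is_distance a b Delta]).

End NetworkNotions.

(** * First-order formulas over [{G, =}] with constants in [C] *)

Definition var := nat.

Inductive term (C : Type) := Var (x : var) | Con (c : C).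

(** In [Quant e x phi] the quantifier is existential iff [e] is true. *)
Inductive form (C : Type) :=
| Truth (b : bool)
| Adj (s t : term C)
| Equal (s t : term C)
| Not (phi : form C)
| And (phi psi : form C)
| Or (phi psi : form C)
| Quant (e : bool) (x : var) (phi : form C).

Arguments Var {C}.
Arguments Truth {C}.

Definition term_eq_dec (C : eqType) : comparable (term C).
Proof. by rewrite /comparable /decidable; decide equality; apply: eq_comparable. Defined.
HB.instance Definition _ (C : eqType) :=
  hasDecEq.Build (term C) (compareP (@term_eq_dec C)).

Definition form_eq_dec (C : eqType) : comparable (form C).
Proof.
rewrite /comparable /decidable; decide equality; first [exact: eq_comparable | exact: term_eq_dec].
Defined.
HB.instance Definition _ (C : eqType) :=
  hasDecEq.Build (form C) (compareP (@form_eq_dec C)).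

Definition map_term (A B : Type) (f : A -> B) (t : term A) : term B :=
  match t with Var x => Var x | Con c => Con (f c) end.

Fixpoint map_form (A B : Type) (f : A -> B) (phi : form A) : form B :=
  match phi with
  | Truth b => Truth b
  | Adj s t => Adj (map_term f s) (map_term f t)
  | Equal s t => Equal (map_term f s) (map_term f t)
  | Not phi => Not (map_form f phi)
  | And phi psi => And (map_form f phi) (map_form f psi)
  | Or phi psi => Or (map_form f phi) (map_form f psi)
  | Quant e x phi => Quant e x (map_form f phi)
  end.

Definition tvars (C : Type) (t : term C) : seq var :=
  if t is Var x then [:: x] else [::].

Definition tconsts (C : Type) (t : term C) : seq C :=
  if t is Con c then [:: c] else [::].

Fixpoint free_vars (C : Type) (phi : form C) : seq var :=
  match phi with
  | Truth _ => [::]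
  | Adj s t | Equal s t => tvars s ++ tvars t
  | Not phi => free_vars phi
  | And phi psi | Or phi psi => free_vars phi ++ free_vars psi
  | Quant _ x phi => [seq y <- free_vars phi | y != x]
  end.

Fixpoint bound_vars (C : Type) (phi : form C) : seq var :=
  match phi with
  | Truth _ | Adj _ _ | Equal _ _ => [::]
  | Not phi => bound_vars phi
  | And phi psi | Or phi psi => bound_vars phi ++ bound_vars psi
  | Quant _ x phi => x :: bound_vars phi
  end.

Fixpoint consts (C : Type) (phi : form C) : seq C :=
  match phi with
  | Truth _ => [::]
  | Adj s t | Equal s t => tconsts s ++ tconsts t
  | Not phi => consts phi
  | And phi psi | Or phi psi => consts phi ++ consts psi
  | Quant _ _ phi => consts phi
  end.

Definition tsubst (C : Type) (x : var) (c : C) (t : term C) : term C :=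
  match t with
  | Var y => if y == x then Con c else t
  | Con _ => t
  end.

(** Only the free occurrences of [x] are replaced. *)
Fixpoint subst (C : Type) (x : var) (c : C) (phi : form C) : form C :=
  match phi with
  | Truth b => Truth b
  | Adj s t => Adj (tsubst x c s) (tsubst x c t)
  | Equal s t => Equal (tsubst x c s) (tsubst x c t)
  | Not phi => Not (subst x c phi)
  | And phi psi => And (subst x c phi) (subst x c psi)
  | Or phi psi => Or (subst x c phi) (subst x c psi)
  | Quant e y phi => Quant e y (if y == x then phi else subst x c phi)
  end.

(** The leftmost quantifier of a sentence, instantiated by [c].  Below a
    Boolean connective the quantifier is extracted first, which dualizes it
    under a negation: the result [(e, psi)] means that [phi] is equivalent to
    [Qx psi(x)], with [Q] existential iff [e], and [psi] is [psi(c)].  On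
    [Quant e x psi] this is [(e, psi(c))]. *)
Fixpoint inst_leftmost (C : Type) (c : C) (phi : form C) :
    option (bool * form C) :=
  match phi with
  | Truth _ | Adj _ _ | Equal _ _ => None
  | Not phi =>
      if inst_leftmost c phi is Some (e, phi') then Some (~~ e, Not phi')
      else None
  | And phi psi =>
      if inst_leftmost c phi is Some (e, phi') then Some (e, And phi' psi)
      else if inst_leftmost c psi is Some (e, psi') then Some (e, And phi psi')
      else None
  | Or phi psi =>
      if inst_leftmost c phi is Some (e, phi') then Some (e, Or phi' psi)
      else if inst_leftmost c psi is Some (e, psi') then Some (e, Or phi psi')
      else None
  | Quant e x phi => Some (e, subst x c phi)
  end.

Fixpoint leftmost (C : Type) (phi : form C) : option bool :=
  match phi with
  | Truth _ | Adj _ _ | Equal _ _ => None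
  | Not phi => omap negb (leftmost phi)
  | And phi psi | Or phi psi =>
      if leftmost phi is Some e then Some e else leftmost psi
  | Quant e _ _ => Some e
  end.

(** The query [phi(x_1, ..., x_l)], posed by the user of the network. *)
Record fo_query (U : eqType) := FOQuery {
  qvars : seq var;
  qform : form U;
  qvars_uniq : uniq qvars;
  qvars_free : {subset free_vars qform <= qvars}
}.

(** Every quantifier is taken to bind a variable of its own (bound variables
    renamed apart), so that the variables are the free variables and one
    variable per quantifier; constants are counted without repetition. *)
Definition num_vars_consts (U : eqType) (q : fo_query U) : nat :=
  size (qvars q) + size (bound_vars (qform q)) +
  size (undup (consts (qform q))).

(** * The query engine *)

Section Engine.
Context (U : eqType).

(** Inside the engine the constants of the posed query ([Cst]) are told apart
    from the identifiers substituted for variables during the evaluation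
    ([Ins], written with an exclamation mark in the queries). *)
Inductive ident := Cst (c : U) | Ins (a : U).

Definition ident_val (i : ident) : U := match i with Cst c => c | Ins a => a end.

Definition ident_cst (i : ident) : seq U := if i is Cst c then [:: c] else [::].

Definition ident_eq_dec : comparable ident.
Proof. by rewrite /comparable /decidable; decide equality; apply: eq_comparable. Defined.
HB.instance Definition _ := hasDecEq.Build ident (compareP ident_eq_dec).

Local Notation iform := (form ident).

(** The number [w'] of variables and constants of a Boolean query.  The
    instantiated identifiers are not counted: they are no longer variables and
    were not constants of the query.  (If they were counted, a subquery would
    get the same clock as its parent, although it is issued later.) *)
Definition clock_width (phi : iform) : nat :=
  size (bound_vars phi) +
  size (undup (flatten [seq ident_cst i | i <- consts phi])).

(** [BoolQ phi] is [?B phi]; [PartQ [:: x_1; ...; x_i] [:: a_(i+1); ...; a_l] phi]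
    is [?x_1 ... ?x_i !a_(i+1) ... !a_l phi]. *)
Inductive query := BoolQ (phi : iform) | PartQ (xs : seq var) (vs : seq U) (phi : iform).

Definition query_eq_dec : comparable query.
Proof.
rewrite /comparable /decidable; decide equality;
  first [exact: form_eq_dec | exact: eq_comparable].
Defined.
HB.instance Definition _ := hasDecEq.Build query (compareP query_eq_dec).

(** [Answer phi b h] is [!B phi] with truth value [b]; [h] is the number of
    hops travelled once the message is received.  After [Delta] hops an answer
    has reached all nodes, in particular those waiting for it, and is not
    forwarded any more. *)
Inductive message := Query (q : query) | Answer (phi : iform) (b : bool) (h : nat).

Record local_data := LocalData {
  own : U;
  nbrs : seq U;
  net_size : nat;
  net_diam : nat
}.

(** [now]: number of completed rounds.  [qtable]: pairs (query, parent), the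
    parent being [None] for a query received from a neighbour or posed by the
    user.  [clocks]: the Boolean queries whose answer was awaited, with the
    value of [now] at which the clock elapses.  [answers] and [results]: answer
    table (answers to Boolean queries, and tuples).  [outbox]: the messages
    broadcast in the last round. *)
Record state := State {
  now : nat;
  qtable : seq (query * option query);
  clocks : seq (iform * nat);
  answers : seq (iform * bool);
  results : seq (seq U);
  outbox : seq message
}.

Definition init_state : state := State 0 [::] [::] [::] [::] [::].

Definition emit (m : message) (s : state) : state :=
  State (now s) (qtable s) (clocks s) (answers s) (results s) (rcons (outbox s) m).

Definition record_query (q : query) (p : option query) (s : state) : state :=
  if (q, p) \in qtable s then s
  else State (now s) (rcons (qtable s) (q, p)) (clocks s) (answers s) (results s) (outbox s).

Definition record_answer (phi : iform) (b : bool) (s : state) : state :=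
  State (now s) (qtable s) (clocks s) (rcons (answers s) (phi, b)) (results s) (outbox s).

Definition record_result (vs : seq U) (s : state) : state :=
  if vs \in results s then s
  else State (now s) (qtable s) (clocks s) (answers s) (rcons (results s) vs) (outbox s).

Definition answer_of (s : state) (phi : iform) : option bool :=
  ohead [seq e.2 | e <- answers s & e.1 == phi].

Definition answered (s : state) (phi : iform) : bool := answer_of s phi != None.

Definition in_qtable (s : state) (q : query) : bool :=
  q \in [seq e.1 | e <- qtable s].

Definition set_clock (D : nat) (phi : iform) (s : state) : state :=
  if phi \in [seq c.1 | c <- clocks s] then s
  else State (now s) (qtable s) (rcons (clocks s) (phi, now s + 2 * D * clock_width phi))
         (answers s) (results s) (outbox s).

Definition waiting (s : state) (phi : iform) : bool :=
  has (fun c => (c.1 == phi) && (now s <= c.2)) (clocks s).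

Definition simp_not (phi : iform) : iform :=
  if phi is Truth b then Truth (~~ b) else Not phi.

Definition simp_and (phi psi : iform) : iform :=
  match phi, psi with
  | Truth b, _ => if b then psi else Truth false
  | _, Truth b => if b then phi else Truth false
  | _, _ => And phi psi
  end.

Definition simp_or (phi psi : iform) : iform :=
  match phi, psi with
  | Truth b, _ => if b then Truth true else psi
  | _, Truth b => if b then Truth true else phi
  | _, _ => Or phi psi
  end.

Definition simp_quant (e : bool) (x : var) (phi : iform) : iform :=
  if phi is Truth b then Truth b else Quant e x phi.

(** Atoms decided by the local data, and propagation of the truth values. *)
Fixpoint simplify (loc : local_data) (phi : iform) : iform :=
  match phi with
  | Truth b => Truth b
  | Adj s t =>
      match s, t with
      | Con b, Con c =>
          if ident_val b == own loc then Truth (ident_val c \in nbrs loc)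
          else if ident_val c == own loc then Truth (ident_val b \in nbrs loc)
          else Adj s t
      | _, _ => Adj s t
      end
  | Equal s t =>
      match s, t with
      | Con b, Con c => Truth (ident_val b == ident_val c)
      | _, _ => Equal s t
      end
  | Not phi => simp_not (simplify loc phi)
  | And phi psi => simp_and (simplify loc phi) (simplify loc psi)
  | Or phi psi => simp_or (simplify loc phi) (simplify loc psi)
  | Quant e x phi => simp_quant e x (simplify loc phi)
  end.

(** What an instance [b] of the Boolean query [phi] says about [phi]: only a
    witness or a counterevidence settles a quantified query; a quantifier-free
    query has the truth value of its simplification. *)
Definition verdict (phi : iform) (b : bool) : option bool :=
  match leftmost phi with
  | Some e => if b == e then Some b else None
  | None => Some b
  end.

(** [learn n phi b]: the node stores the answer [b] to [phi] and, if it is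
    waiting for it, evaluates the parent queries.  [n] bounds the length of the
    chain of parents. *)
Fixpoint learn (n : nat) (phi : iform) (b : bool) (s : state) : state :=
  if n is n'.+1 then
    if answered s phi then s
    else
      let s1 := record_answer phi b s in
      if waiting s phi then
        foldl (fun s' e =>
          if e.1 == BoolQ phi then
            match e.2 with
            | Some (BoolQ p) =>
                if verdict p b is Some b' then
                  if answered s' p then s'
                  else learn n' p b' (emit (Answer p b' 1) s')
                else s'
            | Some (PartQ _ vs _) => if b then record_result vs s' else s'
            | None => s'
            end
          else s') s1 (qtable s)
      else s1
  else s.

Definition learn_answer (phi : iform) (b : bool) (s : state) : state :=
  learn (size (qtable s)).+1 phi b s.

(** The subquery of [p] recorded with parent [p] has truth value [b]. *)
Definition resolve (p : query) (b : bool) (s : state) : state :=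
  match p with
  | BoolQ phi =>
      if verdict phi b is Some b' then
        if answered s phi then s
        else learn_answer phi b' (emit (Answer phi b' 1) s)
      else s
  | PartQ _ vs _ => if b then record_result vs s else s
  end.

(** The node issues ([p] is then the parent, if any) or receives the query
    [q].  [n] bounds the number of nested subqueries. *)
Fixpoint handle (n : nat) (loc : local_data) (q : query) (p : option query)
    (s : state) : state :=
  if n is n'.+1 then
    let issue_sub par phi s :=
      if phi is Truth b then resolve par b s
      else handle n' loc (BoolQ phi) (Some par) s in
    let fresh := ~~ in_qtable s q in
    let s1 := record_query q p s in
    let s2 :=
      match q, p with
      | BoolQ phi, Some par =>
          if answer_of s1 phi is Some b then resolve par b s1
          else set_clock (net_diam loc) phi s1
      | _, _ => s1
      end in
    if ~~ fresh then s2
    else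
      let s3 := emit (Query q) s2 in
      match q with
      | BoolQ phi =>
          if inst_leftmost (Ins (own loc)) phi is Some (_, psi) then
            issue_sub q (simplify loc psi) s3
          else
            let psi := simplify loc phi in
            if psi == phi then s3 else issue_sub q psi s3
      | PartQ [::] _ _ => s3
      | PartQ (x :: xs) vs phi =>
          let xs' := belast x xs in
          let vs' := own loc :: vs in
          let phi' := simplify loc (subst (last x xs) (Ins (own loc)) phi) in
          if xs' is [::] then issue_sub (PartQ [::] vs' phi') phi' s3
          else handle n' loc (PartQ xs' vs' phi') (Some q) s3
      end
  else s.

Definition handle_query (loc : local_data) (q : query) (p : option query) :
    state -> state :=
  let depth :=
    match q with
    | BoolQ phi => size (bound_vars phi)
    | PartQ xs _ phi => size xs + size (bound_vars phi)
    end in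
  handle depth.+2 loc q p.

Definition pose (loc : local_data) (r : fo_query U) (s : state) : state :=
  let phi := simplify loc (map_form Cst (qform r)) in
  if qvars r is [::] then
    if phi is Truth b then resolve (PartQ [::] [::] phi) b s
    else handle_query loc (BoolQ phi) (Some (PartQ [::] [::] phi)) s
  else handle_query loc (PartQ (qvars r) [::] phi) None s.

Definition receive_query (loc : local_data) (s : state) (m : message) : state :=
  if m is Query q then
    if in_qtable s q then s else handle_query loc q None s
  else s.

Definition hops (D : nat) (inbox : seq message) (phi : iform) : nat :=
  foldr (fun m k => if m is Answer psi _ h then
                      if psi == phi then minn h k else k
                    else k) D inbox.

Definition receive_answer (loc : local_data) (inbox : seq message) (s : state)
    (m : message) : state :=
  if m is Answer phi b _ then
    if answered s phi then s
    else
      let h := hops (net_diam loc) inbox phi in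
      learn_answer phi b
        (if h < net_diam loc then emit (Answer phi b h.+1) s else s)
  else s.

(** An elapsed clock settles the query for the waiting node itself; hence that
    answer is not sent, but the answer to the parent query, if settled, is.
    The narrower queries are treated first, as they may be subqueries of the
    others (relevant only if [Delta = 0]). *)
Definition elapse (s : state) : state :=
  let due := [seq c.1 | c <- clocks s & c.2 == now s] in
  foldl (fun s' phi =>
           if leftmost phi is Some e then learn_answer phi (~~ e) s' else s')
    s (sort (fun phi psi => clock_width phi <= clock_width psi) due).

(** One round of a node: [inbox] is what its neighbours broadcast in the
    previous round, [req] the query posed at the node in this round. *)
Definition node_round (loc : local_data) (req : option (fo_query U))
    (inbox : seq message) (s : state) : state :=
  let s0 := State (now s) (qtable s) (clocks s) (answers s) (results s) [::] in
  let s1 := if req is Some r then pose loc r s0 else s0 in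
  let s2 := foldl (receive_query loc) s1 inbox in
  let s3 := foldl (receive_answer loc inbox) s2 inbox in
  let s4 := elapse s3 in
  State (now s4).+1 (qtable s4) (clocks s4) (answers s4) (results s4) (outbox s4).

End Engine.

Arguments init_state {U}.

(** * Executions and distributed time *)

Section Execution.
Context (d : Order.disp_t) (U : orderType d) (D : nat) (G : network U D).
Context (Delta : nat) (r : U) (q : fo_query U).

Definition local_of (v : U) : local_data U :=
  LocalData v (neighbours G v) (size (nodes G)) Delta.

(** State of node [v] after [t] rounds, [q] being posed at [r] at the start. *)
Fixpoint execution (t : nat) (v : U) : state U :=
  if t is t'.+1 then
    node_round (local_of v) (if (t' == 0) && (v == r) then Some q else None)
      (flatten [seq outbox (execution t' u) | u <- neighbours G v])
      (execution t' v)
  else init_state.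

(** Some message is sent along an edge in round [t]. *)
Definition message_sent (t : nat) : Prop :=
  exists u v, [/\ u \in nodes G, edge G u v & outbox (execution t u) <> [::]].

Definition terminated_after (T : nat) : Prop :=
  forall t, T < t -> ~ message_sent t.

Definition is_distributed_time (T : nat) : Prop :=
  terminated_after T /\ forall T', terminated_after T' -> T <= T'.

End Execution.

(* Main.v *)
Require Import Defs.
From HB Require Import structures.
From mathcomp Require Import all_boot all_order.
From mathcomp Require Import zify.
From Stdlib Require Import Classical.

Set Implicit Arguments.
Unset Strict Implicit.
Unset Printing Implicit Defensive.

(** Let the width of a query be its number of variables and constants, the
    instantiated identifiers not being counted.  Every subquery is narrower than
    its parent: either a variable was instantiated, or the query is a
    quantifier-free normal sentence, whose atoms are adjacencies of constants,
    and the simplifying node removed its own identifier from it.  A query is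
    recorded by all nodes at most [Delta] rounds after it was first recorded
    anywhere, so a query of width [k] is first issued after at most
    [Delta * (w - k)] rounds, and its clock of [2 * Delta * k] rounds elapses
    after at most [Delta * (w + k)] rounds.  A node acts on the answer to a
    subquery only while the clock of that subquery runs; so an answer to a query
    of width [k > 0] originates at most [Delta * (w + k - 1)] rounds after the
    start, or is settled while the query itself is spreading, and it is forwarded
    over at most [Delta] hops, which ends by round [2 * Delta * w]. *)

(** * Normal formulas and their width *)

Section Syntax.
Context (U : eqType).
Implicit Types (phi psi : form (ident U)) (loc : local_data U) (v : U).

Definition csts phi : seq U := flatten [seq ident_cst i | i <- consts phi].

Definition is_cst (i : ident U) : bool := if i is Cst _ then true else false.

(** The shape of the Boolean queries in circulation: simplification propagates truth values and
    decides equalities of constants, and an adjacency containing an instantiated identifier is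
    decided by the node that fills its last variable. *)
Fixpoint normal phi : bool :=
  match phi with
  | Truth _ => false
  | Adj (Con i) (Con j) => is_cst i && is_cst j
  | Equal (Con _) (Con _) => false
  | Adj _ _ | Equal _ _ => true
  | Not phi => normal phi
  | And phi psi | Or phi psi => normal phi && normal psi
  | Quant _ _ phi => normal phi
  end.

Definition truth_or_normal phi : bool := if phi is Truth _ then true else normal phi.

(* What instantiating a variable of a normal formula at node [v] produces: the
   atoms that contain an instantiated identifier are decided by [v]. *)
Fixpoint ins_decided v phi : bool :=
  match phi with
  | Adj (Con i) (Con j) =>
      [|| is_cst i && is_cst j, ident_val i == v | ident_val j == v]
  | Truth _ | Adj _ _ | Equal _ _ => true
  | Not phi => ins_decided v phi
  | And phi psi | Or phi psi => ins_decided v phi && ins_decided v psi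
  | Quant _ _ phi => ins_decided v phi
  end.

(** A truth value is absorbed by the connectives and quantifiers above it, so it survives only as
    the whole formula. *)
Lemma simplify_truth_or_normal loc phi :
  ins_decided (own loc) phi -> truth_or_normal (simplify loc phi).
Proof.
elim: phi => [b|[x|i] [y|j]|[x|i] [y|j]|phi IH|phi IH psi IH'|phi IH psi IH'|e x phi IH] //=.
- by case: eqP => //= _; case: eqP => //= _; rewrite !orbF.
- by move=> /IH; case: (simplify loc phi).
- move=> /andP[/IH + /IH'].
  by case: (simplify loc phi) => [[]|s t|s t|?|? ?|? ?|? ? ?] //=;
     case: (simplify loc psi) => [[]|s' t'|s' t'|?|? ?|? ?|? ? ?] //= -> ->.
- move=> /andP[/IH + /IH'].
  by case: (simplify loc phi) => [[]|s t|s t|?|? ?|? ?|? ? ?] //=;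
     case: (simplify loc psi) => [[]|s' t'|s' t'|?|? ?|? ?|? ? ?] //= -> ->.
- by move=> /IH; case: (simplify loc phi).
Qed.

Lemma normal_ins_decided v phi : normal phi -> ins_decided v phi.
Proof.
elim: phi => [b|[x|i] [y|j]|[x|i] [y|j]|phi IH|phi IH psi IH'|phi IH psi IH'|e x phi IH] //=.
- by move=> ->.
- by move=> /andP[/IH -> /IH' ->].
- by move=> /andP[/IH -> /IH' ->].
Qed.

(** An atom that loses its last variable here contains [Ins v]. Below a quantifier on [x] nothing is
    replaced, and normality suffices. *)
Lemma subst_ins_decided v x phi :
  normal phi -> ins_decided v (subst x (Ins v) phi).
Proof.
elim: phi => [b|[y|i] [z|j]|[y|i] [z|j]|phi IH|phi IH psi IH'|phi IH psi IH'|e y phi IH] //=.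
- by do ?[case: ifP => //= _]; rewrite eqxx.
- by case: ifP => //= *; rewrite ?eqxx ?orbT.
- by case: ifP => //= *; rewrite ?eqxx ?orbT.
- by move=> ->.
- by move=> /andP[/IH -> /IH' ->].
- by move=> /andP[/IH -> /IH' ->].
- by case: ifP => // _; apply: normal_ins_decided.
Qed.

Lemma inst_leftmost_ins_decided v phi e psi :
  normal phi -> inst_leftmost (Ins v) phi = Some (e, psi) -> ins_decided v psi.
Proof.
elim: phi e psi => [b|s t|s t|phi IH|phi IH phi' IH'|phi IH phi' IH'|e' y phi _] e psi //=.
- by move=> N; case E: inst_leftmost => [[e' chi]|] // [_ <-]; apply: IH N E.
- move=> /andP[N N']; case E: inst_leftmost => [[e' chi]|].
    by case=> _ <- /=; rewrite (IH _ _ N E) normal_ins_decided.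
  case E': inst_leftmost => [[e' chi]|] //.
  by case=> _ <- /=; rewrite (IH' _ _ N' E') normal_ins_decided.
- move=> /andP[N N']; case E: inst_leftmost => [[e' chi]|].
    by case=> _ <- /=; rewrite (IH _ _ N E) normal_ins_decided.
  case E': inst_leftmost => [[e' chi]|] //.
  by case=> _ <- /=; rewrite (IH' _ _ N' E') normal_ins_decided.
- by move=> N [_ <-]; apply: subst_ins_decided.
Qed.

Lemma map_form_ins_decided v (phi : form U) : ins_decided v (map_form (@Cst U) phi).
Proof.
by elim: phi => [b|[x|i] [y|j]|[x|i] [y|j]|phi IH|phi IH psi IH'|phi IH psi IH'|e x phi IH] //=;
   rewrite IH IH'.
Qed.

Lemma csts_map_form (phi : form U) : csts (map_form (@Cst U) phi) = consts phi.
Proof.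
rewrite /csts; have -> : consts (map_form (@Cst U) phi) = [seq Cst c | c <- consts phi].
  by elim: phi => [b|[x|i] [y|j]|[x|i] [y|j]|phi IH|phi IH psi IH'|phi IH psi IH'|e x phi IH] //=;
     rewrite map_cat IH IH'.
by rewrite -map_comp; elim: (consts phi) => //= c s ->.
Qed.

Lemma bound_vars_map_form (phi : form U) :
  bound_vars (map_form (@Cst U) phi) = bound_vars phi.
Proof. by elim: phi => //= [phi -> psi ->|phi -> psi ->|e x phi ->]. Qed.

Lemma free_vars_map_form (phi : form U) :
  free_vars (map_form (@Cst U) phi) = free_vars phi.
Proof.
by elim: phi => [b|[x|i] [y|j]|[x|i] [y|j]|phi IH|phi IH psi IH'|phi IH psi IH'|e x phi IH] //=;
   rewrite IH ?IH'.
Qed.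

Lemma csts_and phi psi : csts (And phi psi) = csts phi ++ csts psi.
Proof. by rewrite /csts /= map_cat flatten_cat. Qed.

Lemma csts_or phi psi : csts (Or phi psi) = csts phi ++ csts psi.
Proof. by rewrite /csts /= map_cat flatten_cat. Qed.

Lemma csts_adj i j : csts (Adj (Con i) (Con j)) = ident_cst i ++ ident_cst j.
Proof. by rewrite /csts /= cats0. Qed.

Lemma simp_and_cases phi psi :
  [\/ simp_and phi psi = And phi psi, simp_and phi psi = phi, simp_and phi psi = psi
    | exists b, simp_and phi psi = Truth b].
Proof.
by case: phi => [[]|? ?|? ?|?|? ?|? ?|? ? ?]; case: psi => [[]|? ?|? ?|?|? ?|? ?|? ? ?];
   solve [constructor 1 => // | constructor 2 => // | constructor 3 => //
         | constructor 4; eexists=> //].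
Qed.

Lemma simp_or_cases phi psi :
  [\/ simp_or phi psi = Or phi psi, simp_or phi psi = phi, simp_or phi psi = psi
    | exists b, simp_or phi psi = Truth b].
Proof.
by case: phi => [[]|? ?|? ?|?|? ?|? ?|? ? ?]; case: psi => [[]|? ?|? ?|?|? ?|? ?|? ? ?];
   solve [constructor 1 => // | constructor 2 => // | constructor 3 => //
         | constructor 4; eexists=> //].
Qed.

Lemma simplify_sub loc phi :
  [/\ {subset free_vars (simplify loc phi) <= free_vars phi},
      size (bound_vars (simplify loc phi)) <= size (bound_vars phi) &
      {subset csts (simplify loc phi) <= csts phi}].
Proof.
elim: phi => [b|[x|i] [y|j]|[x|i] [y|j]|phi [IHf IHb IHc]|phi [IHf IHb IHc] psi [IHf' IHb' IHc']
  |phi [IHf IHb IHc] psi [IHf' IHb' IHc']|e x phi [IHf IHb IHc]] //=.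
all: try by split.
- by case: ifP => _; [|case: ifP => _]; split.
- by move: IHf IHb IHc; case: (simplify loc phi).
- rewrite csts_and size_cat.
  case: (simp_and_cases (simplify loc phi) (simplify loc psi)) => [->|->|->|[b ->]];
    split=> //=; rewrite ?csts_and ?size_cat; try lia; move=> y; rewrite !mem_cat.
  + by case/orP => [/IHf|/IHf'] ->; rewrite ?orbT.
  + by case/orP => [/IHc|/IHc'] ->; rewrite ?orbT.
  + by move/IHf ->.
  + by move/IHc ->.
  + by move/IHf' ->; rewrite orbT.
  + by move/IHc' ->; rewrite orbT.
- rewrite csts_or size_cat.
  case: (simp_or_cases (simplify loc phi) (simplify loc psi)) => [->|->|->|[b ->]];
    split=> //=; rewrite ?csts_or ?size_cat; try lia; move=> y; rewrite !mem_cat.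
  + by case/orP => [/IHf|/IHf'] ->; rewrite ?orbT.
  + by case/orP => [/IHc|/IHc'] ->; rewrite ?orbT.
  + by move/IHf ->.
  + by move/IHc ->.
  + by move/IHf' ->; rewrite orbT.
  + by move/IHc' ->; rewrite orbT.
- have S : {subset [seq y <- free_vars (simplify loc phi) | y != x]
      <= [seq y <- free_vars phi | y != x]}.
    by move=> y; rewrite !mem_filter => /andP[-> /IHf].
  by move: S IHb IHc; case: (simplify loc phi).
Qed.

Lemma clock_width_le phi psi :
  size (bound_vars phi) <= size (bound_vars psi) -> {subset csts phi <= csts psi} ->
  clock_width phi <= clock_width psi.
Proof.
move=> B C; apply: leq_add => //; apply: uniq_leq_size (undup_uniq _) _ => y.
by rewrite !mem_undup => /C.
Qed.

Lemma clock_width_simplify loc phi : clock_width (simplify loc phi) <= clock_width phi.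
Proof. by have [_ B C] := simplify_sub loc phi; apply: clock_width_le. Qed.

Lemma subst_sub x v phi :
  [/\ {subset free_vars (subst x (Ins v) phi) <= [seq y <- free_vars phi | y != x]},
      bound_vars (subst x (Ins v) phi) = bound_vars phi &
      csts (subst x (Ins v) phi) = csts phi].
Proof.
have T t : tvars (tsubst x (Ins v) t) = [seq y <- tvars t | y != x].
  by case: t => //= y; case: eqP.
have T' t : flatten [seq ident_cst i | i <- tconsts (tsubst x (Ins v) t)] =
            flatten [seq ident_cst i | i <- tconsts t].
  by case: t => //= y; case: eqP.
elim: phi => [b|s t|s t|phi [IHf IHb IHc]|phi [IHf IHb IHc] psi [IHf' IHb' IHc']
  |phi [IHf IHb IHc] psi [IHf' IHb' IHc']|e y phi [IHf IHb IHc]] //=.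
- by rewrite !T -filter_cat /csts /= !map_cat !flatten_cat !T'; split.
- by rewrite !T -filter_cat /csts /= !map_cat !flatten_cat !T'; split.
- rewrite IHb IHb' csts_and IHc IHc' -csts_and; split=> // z.
  by rewrite filter_cat !mem_cat => /orP[/IHf|/IHf'] ->; rewrite ?orbT.
- rewrite IHb IHb' csts_or IHc IHc' -csts_or; split=> // z.
  by rewrite filter_cat !mem_cat => /orP[/IHf|/IHf'] ->; rewrite ?orbT.
- case: eqP => [->|_].
    by split=> // z; rewrite !mem_filter => /andP[-> ->].
  split=> //; [move=> z | by rewrite IHb]; rewrite !mem_filter => /andP[-> /IHf].
  by rewrite mem_filter => /andP[-> ->].
Qed.

Lemma clock_width_subst x v phi : clock_width (subst x (Ins v) phi) = clock_width phi.
Proof. by have [_ B C] := subst_sub x v phi; rewrite /clock_width B -!/(csts _) C. Qed.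

Lemma inst_leftmost_sub v phi e psi : inst_leftmost (Ins v) phi = Some (e, psi) ->
  [/\ {subset free_vars psi <= free_vars phi},
      size (bound_vars phi) = (size (bound_vars psi)).+1 & csts psi = csts phi].
Proof.
elim: phi e psi => [b|s t|s t|phi IH|phi IH phi' IH'|phi IH phi' IH'|e' y phi _] e psi //=.
- by case E: inst_leftmost => [[e' chi]|] // [_ <-]; apply: IH E.
- case E: inst_leftmost => [[e' chi]|].
    case=> _ <- /=; have [F B C] := IH _ _ E; split.
    + by move=> z; rewrite !mem_cat => /orP[/F|] ->; rewrite ?orbT.
    + by rewrite !size_cat B.
    + by rewrite !csts_and C.
  case E': inst_leftmost => [[e' chi]|] // [_ <-] /=; have [F B C] := IH' _ _ E'; split.
  + by move=> z; rewrite !mem_cat => /orP[|/F] ->; rewrite ?orbT.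
  + by rewrite !size_cat B addnS.
  + by rewrite !csts_and C.
- case E: inst_leftmost => [[e' chi]|].
    case=> _ <- /=; have [F B C] := IH _ _ E; split.
    + by move=> z; rewrite !mem_cat => /orP[/F|] ->; rewrite ?orbT.
    + by rewrite !size_cat B.
    + by rewrite !csts_or C.
  case E': inst_leftmost => [[e' chi]|] // [_ <-] /=; have [F B C] := IH' _ _ E'; split.
  + by move=> z; rewrite !mem_cat => /orP[|/F] ->; rewrite ?orbT.
  + by rewrite !size_cat B addnS.
  + by rewrite !csts_or C.
- by move=> [_ <-]; have [F B C] := subst_sub y v phi; rewrite B.
Qed.

(** The quantifier disappears, and the identifier that replaces its variable is not counted. *)
Lemma clock_width_inst_leftmost v phi e psi :
  inst_leftmost (Ins v) phi = Some (e, psi) -> clock_width phi = (clock_width psi).+1.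
Proof. by case/inst_leftmost_sub=> _ B C; rewrite /clock_width B -!/(csts _) C. Qed.

Lemma inst_leftmost_None v phi : inst_leftmost (Ins v) phi = None -> bound_vars phi = [::].
Proof.
elim: phi => //= [phi|phi IH psi IH'|phi IH psi IH'].
- by case: inst_leftmost => [[]|].
- by case: inst_leftmost IH => [[]|] // ->; case: inst_leftmost IH' => [[]|] // ->.
- by case: inst_leftmost IH => [[]|] // ->; case: inst_leftmost IH' => [[]|] // ->.
Qed.

(** The only atoms of a normal formula that a node decides are adjacencies with its own
    identifier. *)
Lemma simplify_id loc phi : normal phi -> own loc \notin csts phi -> simplify loc phi = phi.
Proof.
elim: phi => [b|[x|i] [y|j]|[x|i] [y|j]|phi IH|phi IH psi IH'|phi IH psi IH'|e x phi IH] //=.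
- by rewrite csts_adj; case: i j => i [] j //=; rewrite !inE !(eq_sym (own loc));
     case: eqP => //= _; case: eqP.
- by move=> N /(IH N) ->; case: (phi) N.
- rewrite csts_and mem_cat negb_or => /andP[N N'] /andP[/(IH N) -> /(IH' N') ->].
  by case: (phi) N => // *; case: (psi) N'.
- rewrite csts_or mem_cat negb_or => /andP[N N'] /andP[/(IH N) -> /(IH' N') ->].
  by case: (phi) N => // *; case: (psi) N'.
- by move=> N /(IH N) ->; case: (phi) N.
Qed.

Lemma cat_nil (T : Type) (s t : seq T) : s ++ t = [::] -> s = [::] /\ t = [::].
Proof. by case: s. Qed.

(* In a quantifier-free normal sentence all atoms are adjacencies of two
   constants, so the node [c] decides every atom in which [c] occurs. *)
Lemma own_notin_simplify loc phi : normal phi -> bound_vars phi = [::] ->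
  free_vars phi = [::] -> own loc \notin csts (simplify loc phi).
Proof.
elim: phi => [b|[x|i] [y|j]|[x|i] [y|j]|phi IH|phi IH psi IH'|phi IH psi IH'|e x phi IH] //=.
- case: eqP => // Hi; case: eqP => // Hj; rewrite csts_adj.
  case: i j Hi Hj => i [] j //= Hi Hj _ _ _; rewrite !inE.
  by apply/norP; split; apply/eqP => E; [apply: Hi|apply: Hj].
- by move=> N B F; move: (IH N B F); case: (simplify loc phi).
- move=> /andP[N N'] /cat_nil[B B'] /cat_nil[F F'].
  move: (IH N B F) (IH' N' B' F') => C C'.
  case: (simp_and_cases (simplify loc phi) (simplify loc psi)) => [->|->|->|[b ->]] //.
  by rewrite csts_and mem_cat negb_or C.
- move=> /andP[N N'] /cat_nil[B B'] /cat_nil[F F'].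
  move: (IH N B F) (IH' N' B' F') => C C'.
  case: (simp_or_cases (simplify loc phi) (simplify loc psi)) => [->|->|->|[b ->]] //.
  by rewrite csts_or mem_cat negb_or C.
Qed.

(** If the sentence changes, the node's own identifier was among its constants and is gone
    afterwards: one distinct constant fewer. *)
Lemma clock_width_simplify_lt loc phi : normal phi -> bound_vars phi = [::] ->
  free_vars phi = [::] -> simplify loc phi != phi ->
  clock_width (simplify loc phi) < clock_width phi.
Proof.
move=> N B F neq.
have [own_in|/(simplify_id N) E] := boolP (own loc \in csts phi); last by rewrite E eqxx in neq.
have [_ Bs Cs] := simplify_sub loc phi.
rewrite /clock_width -!/(csts _) -addnS; apply: leq_add => //.
suff: size (own loc :: undup (csts (simplify loc phi))) <= size (undup (csts phi)) by [].
apply: uniq_leq_size => [|y].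
  by rewrite /= undup_uniq mem_undup own_notin_simplify.
by rewrite inE !mem_undup => /orP[/eqP ->|/Cs].
Qed.

(** A normal formula has an atom, and without quantifiers the arguments of an atom in a sentence are
    constants of the posed query. *)
Lemma clock_width_gt0 phi : normal phi -> free_vars phi = [::] -> 0 < clock_width phi.
Proof.
move=> N F; rewrite /clock_width -/(csts _) addn_gt0 -implyNb -eqn0Ngt size_eq0.
apply/implyP => /eqP B; rewrite lt0n size_eq0.
suff: csts phi != [::].
  apply: contra_neq => E; case C: (csts phi) => [//|c s].
  by have := mem_undup (csts phi) c; rewrite E C mem_head.
elim: phi N F B => [b|[x|i] [y|j]|[x|i] [y|j]|phi IH|phi IH psi IH'|phi IH psi IH'|e x phi IH] //=.
- by rewrite csts_adj; case: i.
- move=> /andP[N N'] /cat_nil[F F'] /cat_nil[B B'].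
  by rewrite csts_and; case: (csts phi) (IH N F B).
- move=> /andP[N N'] /cat_nil[F F'] /cat_nil[B B'].
  by rewrite csts_or; case: (csts phi) (IH N F B).
Qed.

End Syntax.

(** * Steps of a node: growth of the query table and the outbox *)

Definition message_eq_dec (U : eqType) : comparable (message U).
Proof.
rewrite /comparable /decidable; decide equality;
  first [exact: eq_comparable | exact: form_eq_dec].
Defined.
HB.instance Definition _ (U : eqType) :=
  hasDecEq.Build (message U) (compareP (@message_eq_dec U)).

Lemma foldl_closed (S : Type) (T : eqType) (P : S -> Prop) (f : S -> T -> S) s l :
  P s -> (forall s' x, x \in l -> P s' -> P (f s' x)) -> P (foldl f s l).
Proof.
elim: l s => //= x l IH s Ps Pf; apply: IH => [|s' y yl]; apply: Pf => //.
  exact: mem_head.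
by rewrite inE yl orbT.
Qed.

Section Steps.
Context (U : eqType).
Implicit Types (s : state U) (q : query U) (loc : local_data U).

(** [learn] emits an answer only to a recorded parent and only while the clock of the subquery runs,
    so emissions are checked in that situation alone. *)
Lemma learn_closed (P : state U -> Prop) :
  (forall s phi b, P s -> P (record_answer phi b s)) ->
  (forall s vs, P s -> P (record_result vs s)) ->
  (forall s phi p b, (BoolQ phi, Some (BoolQ p)) \in qtable s -> waiting s phi ->
     P s -> P (emit (Answer p b 1) s)) ->
  forall n phi b s, P s -> P (learn n phi b s).
Proof.
move=> Pa Pr Pe n phi b s Ps.
(* These components never change in [learn], so the table entry and the waiting test still hold in
   the middle of the fold. *)
pose core s' := (now s', qtable s', clocks s').
suff: P (learn n phi b s) /\ core (learn n phi b s) = core s by case.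
elim: n phi b s Ps => //= n IH phi b s Ps.
case: ifP => // _; case: ifP => [wait|_]; last by split=> //; apply: Pa.
apply: (foldl_closed (P := fun s' => P s' /\ core s' = core s)) => [|s' [q p] in_s [Ps' Es']].
  by split=> //; apply: Pa.
have [En Eq Ec] := Es'.
case: eqP => //= Eqphi; case: p in_s => // [[p|xs vs p]] in_s.
  case: verdict => // b'; case: ifP => // _.
  have [|Pl ->] := IH p b' (emit (Answer p b' 1) s') _; last by [].
  apply: (Pe _ phi) Ps'; rewrite ?Eq; first by rewrite -Eqphi.
  by move: wait; rewrite /waiting En Ec.
case: b => //; split; first exact: Pr.
by rewrite -Es' /record_result; case: ifP.
Qed.

Lemma resolve_closed (P : state U -> Prop) :
  (forall s phi b, P s -> P (record_answer phi b s)) ->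
  (forall s vs, P s -> P (record_result vs s)) ->
  (forall s phi p b, (BoolQ phi, Some (BoolQ p)) \in qtable s -> waiting s phi ->
     P s -> P (emit (Answer p b 1) s)) ->
  forall par b s, (forall phi b', P (emit (Answer phi b' 1) s)) -> P s ->
    P (resolve par b s).
Proof.
move=> Pa Pr Pe [phi|xs vs phi] b s Pes Ps /=; last by case: b => //; apply: Pr.
case: verdict => // b'; case: ifP => // _.
exact: learn_closed.
Qed.

(* A query enters the table only together with its broadcast. *)
Definition extends s s' : Prop :=
  [/\ {subset qtable s <= qtable s'}, {subset outbox s <= outbox s'} &
      forall q, in_qtable s' q -> in_qtable s q || (Query q \in outbox s')].

Lemma extends_refl s : extends s s.
Proof. by split=> // q ->. Qed.

Lemma extends_trans s2 s1 s3 : extends s1 s2 -> extends s2 s3 -> extends s1 s3.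
Proof.
move=> [Q O N] [Q' O' N']; split=> [e /Q /Q'|m /O /O'|q /N'] //.
by case/orP => [/N|->]; [case/orP => [->|/O' ->]|]; rewrite ?orbT.
Qed.

Lemma extends_in_qtable s s' q : extends s s' -> in_qtable s q -> in_qtable s' q.
Proof. by case=> Q _ _ /mapP[e /Q e_in ->]; apply: map_f. Qed.

Lemma emit_extends m s : extends s (emit m s).
Proof.
split=> [//|m' in_s|q in_s] /=; first by rewrite mem_rcons inE in_s orbT.
by apply/orP; left.
Qed.

Lemma record_result_extends vs s : extends s (record_result vs s).
Proof. by rewrite /record_result; case: ifP => _; apply: extends_refl. Qed.

Lemma learn_extends n phi b s : extends s (learn n phi b s).
Proof.
apply: learn_closed; last exact: extends_refl.
- by move=> s' *; apply: extends_trans (extends_refl s').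
- by move=> s' vs E; apply: extends_trans E (record_result_extends _ _).
- by move=> s' ? ? ? _ _ E; apply: extends_trans E (emit_extends _ _).
Qed.

Lemma resolve_extends p b s : extends s (resolve p b s).
Proof.
apply: resolve_closed; last exact: extends_refl.
- by move=> s' *; apply: extends_trans (extends_refl s').
- by move=> s' vs E; apply: extends_trans E (record_result_extends _ _).
- by move=> s' ? ? ? _ _ E; apply: extends_trans E (emit_extends _ _).
- by move=> *; apply: emit_extends.
Qed.

Lemma set_clock_extends k phi s : extends s (set_clock k phi s).
Proof. by rewrite /set_clock; case: ifP => _; apply: extends_refl. Qed.

Lemma await_extends k q p s :
  extends s (match q, p with
             | BoolQ phi, Some par =>
                 if answer_of s phi is Some b then resolve par b s
                 else set_clock k phi s
             | _, _ => s
             end).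
Proof.
case: q => [phi|*]; last exact: extends_refl.
case: p => [par|]; last exact: extends_refl.
by case: answer_of => [b|]; [apply: resolve_extends|apply: set_clock_extends].
Qed.

Lemma record_query_in q p s : in_qtable (record_query q p s) q.
Proof.
rewrite /record_query; case: ifP => [in_s|_]; first by apply/mapP; exists (q, p).
by apply/mapP; exists (q, p); rewrite //= mem_rcons mem_head.
Qed.

Lemma in_record_query q p s q' :
  in_qtable (record_query q p s) q' = (q' == q) || in_qtable s q'.
Proof.
rewrite /record_query; case: ifP => [in_s|_].
  by case: eqP => // ->; apply/mapP; exists (q, p).
by rewrite /in_qtable /= map_rcons mem_rcons inE.
Qed.

(** Recording without broadcasting breaks [extends]; the gap closes if the query was in the table
    before, or once it is emitted. *)
Lemma record_query_extends q p s s' :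
  extends (record_query q p s) s' ->
  (in_qtable s q -> extends s s') /\ extends s (emit (Query q) s').
Proof.
move=> [Q O N].
have Q1 : {subset qtable s <= qtable s'}.
  move=> e in_s; apply: Q; rewrite /record_query; case: ifP => //= _.
  by rewrite mem_rcons inE in_s orbT.
have O1 : {subset outbox s <= outbox s'}.
  by move=> m in_s; apply: O; rewrite /record_query; case: ifP.
split=> [in_s|]; split=> //.
- move=> q' /N; rewrite in_record_query => /orP[/orP[/eqP ->|->]|->];
    by rewrite ?in_s ?orbT.
- by move=> m /O1 /=; rewrite mem_rcons inE => ->; rewrite orbT.
- move=> q'; rewrite [outbox _]/= mem_rcons inE => /N.
  by rewrite in_record_query => /orP[/orP[/eqP ->|->]|->]; rewrite ?eqxx ?orbT.
Qed.

Lemma handle_extends n loc q p s :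
  extends s (handle n loc q p s) /\ (0 < n -> in_qtable (handle n loc q p s) q).
Proof.
elim: n q p s => [|n IH] q p s; first by split=> //; apply: extends_refl.
set issue := fun par phi s => if phi is Truth b then resolve par b s
                              else handle n loc (BoolQ phi) (Some par) s.
have issue_ext par phi s' : extends s' (issue par phi s').
  by rewrite /issue; case: phi => [b|*|*|*|*|*|*]; [apply: resolve_extends|..];
     apply: (IH _ _ _).1.
cbn [handle]; rewrite -/issue; set s1 := record_query q p s.
set s2 := match q, p with BoolQ _, Some _ => _ | _, _ => _ end.
have E2 : extends s1 s2 by apply: await_extends.
have [Eold Enew] := record_query_extends E2.
have in2 : in_qtable s2 q by apply: extends_in_qtable E2 (record_query_in _ _ _).
case: ifP => [|_]; first by rewrite negbK => in_s; split=> //; apply: Eold.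
set s3 := emit (Query q) s2 in Enew *.
suff E3 s' : extends s3 s' -> extends s s' /\ (0 < n.+1 -> in_qtable s' q).
  apply: E3; move: @s3 Enew => s3 _.
  case: (q) => [phi|[|x xs] vs phi].
  - case: inst_leftmost => [[e psi]|]; first exact: issue_ext.
    by case: ifP => _; [apply: extends_refl|apply: issue_ext].
  - exact: extends_refl.
  - by case: (belast x xs) => [|y ys]; [apply: issue_ext|apply: (IH _ _ _).1].
move=> E; split=> [|_]; first exact: extends_trans Enew E.
exact: extends_in_qtable E _.
Qed.

Lemma handle_query_extends loc q p s : extends s (handle_query loc q p s).
Proof. exact: (handle_extends _ _ _ _ _).1. Qed.

Lemma pose_extends loc r s : extends s (pose loc r s).
Proof.
rewrite /pose; case: qvars => [|x xs]; last exact: handle_query_extends.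
by case: simplify => [b|*|*|*|*|*|*];
   first [exact: resolve_extends | exact: handle_query_extends].
Qed.

Lemma receive_query_extends loc s m : extends s (receive_query loc s m).
Proof.
case: m => [q|*] /=; last exact: extends_refl.
by case: ifP => _; [apply: extends_refl|apply: handle_query_extends].
Qed.

Lemma receive_answer_extends loc inbox s m : extends s (receive_answer loc inbox s m).
Proof.
case: m => [q|phi b h] /=; first exact: extends_refl.
case: ifP => _; first exact: extends_refl.
apply: extends_trans (learn_extends _ _ _ _).
by case: ifP => _; [apply: emit_extends|apply: extends_refl].
Qed.

Lemma foldl_extends (T : eqType) (f : state U -> T -> state U) s l :
  (forall s' x, extends s' (f s' x)) -> extends s (foldl f s l).
Proof.
move=> E; apply: foldl_closed => [|s' x _ Es']; first exact: extends_refl.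
exact: extends_trans Es' (E _ _).
Qed.

Lemma elapse_extends s : extends s (elapse s).
Proof.
apply: foldl_extends => s' phi; case: leftmost => [e|]; last exact: extends_refl.
exact: learn_extends.
Qed.

Lemma receive_queries_in loc s inbox q :
  Query q \in inbox -> in_qtable (foldl (receive_query loc) s inbox) q.
Proof.
elim: inbox s => //= m inbox IH s; rewrite inE => /orP[/eqP <-|]; last exact: IH.
apply: extends_in_qtable (foldl_extends _ _ (receive_query_extends loc)) _ => /=.
by case: ifP => // _; apply: (handle_extends _ _ _ _ _).2.
Qed.

Definition silent s : state U :=
  State (now s) (qtable s) (clocks s) (answers s) (results s) [::].

(** The two ingredients of flooding: a new query is broadcast in the round that records it, and a
    received query is recorded. The outbox is emptied first, hence [silent s]. *)
Lemma node_round_extends loc req inbox s :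
  extends (silent s) (node_round loc req inbox s) /\
  forall q, Query q \in inbox -> in_qtable (node_round loc req inbox s) q.
Proof.
rewrite /node_round -/(silent s); set s1 := (if req is Some r then _ else _).
have E1 : extends (silent s) s1.
  by rewrite /s1; case: (req) => [r|]; [apply: pose_extends|apply: extends_refl].
set s2 := foldl _ s1 inbox; set s3 := foldl _ s2 inbox.
have E2 : extends s1 s2 by apply: foldl_extends; apply: receive_query_extends.
have E3 : extends s2 (elapse s3).
  apply: extends_trans (elapse_extends s3).
  by apply: foldl_extends; apply: receive_answer_extends.
split=> [|q q_in]; first exact: extends_trans E1 (extends_trans E2 E3).
exact: extends_in_qtable E3 (receive_queries_in _ _ q_in).
Qed.

End Steps.

(** * The invariant of a node within one round *)

Section Round.
Context (U : eqType).
Implicit Types (s : state U) (q : query U) (loc : local_data U).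

Definition query_width q : nat :=
  match q with
  | BoolQ phi => clock_width phi
  | PartQ xs _ phi => size xs + clock_width phi
  end.

(** A partial query without variables serves only as a parent and is never sent. While variables
    remain, its formula may already be a truth value. *)
Definition wf_query q : Prop :=
  match q with
  | BoolQ phi => normal phi /\ free_vars phi = [::]
  | PartQ xs _ phi =>
      [/\ xs <> [::], truth_or_normal phi & {subset free_vars phi <= xs}]
  end.

Lemma query_width_gt0 q : wf_query q -> 0 < query_width q.
Proof. by case: q => [phi []|[|x xs] vs phi []] //; apply: clock_width_gt0. Qed.

Lemma subset_nil (T : eqType) (s : seq T) : {subset s <= [::]} -> s = [::].
Proof. by case: s => // x s /(_ x); rewrite mem_head => /(_ isT). Qed.

Context (Delta w n : nat) (recorded known : query U -> Prop).
Context (Delta_gt0 : 0 < Delta).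
(** A query of width [k] appears by [Delta * (w - k)]; spreading adds [Delta]. *)
Context (known_flooded :
  forall q, known q -> ~ recorded q -> n <= Delta * (w - query_width q).+1).

(* [n] is the number of completed rounds, [recorded] the query table of the node
   at the start of the round, and [known] the queries that are in circulation. *)
Definition query_ok q : Prop :=
  [/\ wf_query q, query_width q <= w & known q \/ n <= Delta * (w - query_width q)].

(** Only the answer to a Boolean parent is sent; the strict inequality reserves [Delta] rounds for
    its journey. *)
Definition parent_ok q (p : option (query U)) : bool :=
  match q, p with
  | BoolQ phi, Some (BoolQ psi) => clock_width phi < clock_width psi <= w
  | _, _ => true
  end.

(** What is emitted after [n] completed rounds belongs to round [n + 1]. An answer with hop count
    [h] has at most [Delta - h] forwardings left, and the last must fall within [2 * Delta * w]. *)
Definition message_ok (m : message U) : bool :=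
  match m with
  | Query _ => n < 2 * Delta * w
  | Answer _ _ h => (n + 1 + Delta <= 2 * Delta * w + h) && (h <= Delta)
  end.

Record round_inv s : Prop := RoundInv {
  inv_now : now s = n;
  inv_recorded : forall q, recorded q -> in_qtable s q;
  inv_qtable : forall e, e \in qtable s -> query_ok e.1 /\ parent_ok e.1 e.2;
  inv_clocks : forall c, c \in clocks s -> c.2 <= Delta * (w + clock_width c.1);
  inv_outbox : forall m, m \in outbox s -> message_ok m;
  inv_queries : forall q, Query q \in outbox s -> in_qtable s q
}.

Lemma emit_answer_inv phi b h s :
  message_ok (Answer phi b h) -> round_inv s -> round_inv (emit (Answer phi b h) s).
Proof.
move=> ok [I1 I2 I3 I4 I5 I6]; split=> // [m|q] /=; rewrite mem_rcons inE.
  by case/orP => [/eqP ->|/I5].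
by case/orP => [/eqP|/I6].
Qed.

Lemma record_answer_inv s phi b : round_inv s -> round_inv (record_answer phi b s).
Proof. by case. Qed.

Lemma record_result_inv s vs : round_inv s -> round_inv (record_result vs s).
Proof. by rewrite /record_result; case: ifP => // _ []. Qed.

(* A node acts on the answer to a subquery only before the clock of that
   subquery elapses. *)
Lemma emit_parent_inv s phi p b :
  (BoolQ phi, Some (BoolQ p)) \in qtable s -> waiting s phi -> round_inv s ->
  round_inv (emit (Answer p b 1) s).
Proof.
move=> q_in /hasP[c c_in /andP[/eqP Ec le_now]] I; apply: emit_answer_inv => //.
have [_ /= /andP[lt_phi le_w]] := inv_qtable I q_in.
have := inv_clocks I c_in; rewrite (inv_now I) Ec in le_now *.
move=> /(leq_trans le_now) le_n; rewrite Delta_gt0 andbT.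
(* The subquery is narrower than its parent, so [Delta] rounds remain after its clock has
   elapsed. *)
have : Delta * (w + clock_width phi).+1 <= Delta * (w + w) by rewrite leq_mul2l; lia.
by rewrite mulnS -mulnA; lia.
Qed.

Lemma learn_inv k phi b s : round_inv s -> round_inv (learn k phi b s).
Proof.
exact: (learn_closed record_answer_inv record_result_inv emit_parent_inv).
Qed.

(** Covers answers found on the spot, where no clock bounds the time. *)
Lemma resolve_inv p b s :
  n + Delta <= 2 * Delta * w -> round_inv s -> round_inv (resolve p b s).
Proof.
move=> le_n I.
apply: (resolve_closed record_answer_inv record_result_inv emit_parent_inv) => // phi b'.
by apply: emit_answer_inv => //=; rewrite Delta_gt0 andbT; lia.
Qed.

Lemma record_query_inv q p s : query_ok q -> parent_ok q p -> round_inv s ->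
  round_inv (record_query q p s).
Proof.
move=> okq okp [I1 I2 I3 I4 I5 I6]; split=> //.
- by rewrite /record_query; case: ifP.
- by move=> q' /I2; rewrite in_record_query => ->; rewrite orbT.
- move=> e; rewrite /record_query; case: ifP => _; first exact: I3.
  by rewrite /= mem_rcons inE => /orP[/eqP ->|/I3].
- by move=> c; rewrite /record_query; case: ifP => _; apply: I4.
- by move=> m; rewrite /record_query; case: ifP => _; apply: I5.
- move=> q'; rewrite in_record_query => H; apply/orP; right; apply: I6.
  by move: H; rewrite /record_query; case: ifP.
Qed.

Lemma emit_query_inv q s : n < 2 * Delta * w -> in_qtable s q -> round_inv s ->
  round_inv (emit (Query q) s).
Proof.
move=> lt_n q_in [I1 I2 I3 I4 I5 I6]; split=> // [m|q'] /=; rewrite mem_rcons inE.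
  by case/orP => [/eqP ->|/I5].
by case/orP => [/eqP [->]|/I6].
Qed.

Lemma set_clock_inv phi s : n <= Delta * (w - clock_width phi) -> clock_width phi <= w ->
  round_inv s -> round_inv (set_clock Delta phi s).
Proof.
move=> le_n le_w I; rewrite /set_clock; case: ifP => // _.
case: I => I1 I2 I3 I4 I5 I6; split=> // c /=; rewrite mem_rcons inE.
case/orP => [/eqP ->|/I4 //] /=; rewrite I1.
(* Issued by [Delta * (w - k)] and running [2 * Delta * k] rounds, a clock of width [k] elapses by
   [Delta * (w + k)]. *)
have -> : w + clock_width phi = (w - clock_width phi) + 2 * clock_width phi by lia.
by rewrite mulnDr; apply: leq_add => //; rewrite mulnCA mulnA.
Qed.

(** A fresh query of width [k] is handled by [Delta * (w - k).+1], which lies within the issue bound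
    [Delta * (w - k')] of any subquery of width [k' < k]. The issue bound is asked only of queries
    with a parent, since a received query sets no clock. *)
Lemma handle_inv k loc q p s : net_diam loc = Delta ->
  query_ok q -> parent_ok q p -> (p -> n <= Delta * (w - query_width q)) ->
  round_inv s -> round_inv (handle k loc q p s).
Proof.
move=> Edelta; elim: k q p s => // k IH q p s okq okp le_n I.
set issue := fun par phi s => if phi is Truth b then resolve par b s
                              else handle k loc (BoolQ phi) (Some par) s.
cbn [handle]; rewrite -/issue Edelta.
have [wfq le_q kn] := okq; have q_gt0 := query_width_gt0 wfq.
have le_mul a b : a <= b -> Delta * a <= Delta * b by move=> ?; rewrite leq_mul2l; lia.
have w2 : 2 * Delta * w = Delta * w + Delta * w by lia.
set s1 := record_query q p s.
have I1 : round_inv s1 by apply: record_query_inv.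
set s2 := match q, p with BoolQ _, Some _ => _ | _, _ => _ end.
have I2 : round_inv s2.
  rewrite /s2; case: (q) wfq le_q q_gt0 le_n => [phi|xs vs phi] //= wfq le_q q_gt0.
  case: (p) => [par|] // /(_ isT) le_n.
  case: answer_of => [b|]; last exact: set_clock_inv.
  (* As the width is positive, [Delta] rounds are left to spread the answer. *)
  apply: resolve_inv => //; have := le_mul (w - clock_width phi).+1 w.
  by rewrite mulnS; lia.
case: ifP => [//|/negbT/negbNE fresh].
have E2 : in_qtable s2 q.
  exact: extends_in_qtable (await_extends _ _ _ _) (record_query_in q p s).
(* Either the query is within its issue bound, or it is in circulation and still on its way to this
   node. *)
have lt_n : n <= Delta * (w - query_width q).+1.
  case: kn => [kn|le]; last by apply: leq_trans le _; apply: le_mul.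
  by apply: known_flooded => // /(inv_recorded I); rewrite (negbTE fresh).
have w_gt0 : Delta <= Delta * w by rewrite leq_pmulr; lia.
have le_w : n <= Delta * w by apply: leq_trans lt_n _; apply: le_mul; lia.
have I3 : round_inv (emit (Query q) s2) by apply: emit_query_inv => //; lia.
have issue_inv par phi s' : round_inv s' -> truth_or_normal phi -> free_vars phi = [::] ->
    clock_width phi < query_width q -> parent_ok (BoolQ phi) (Some par) ->
    round_inv (issue par phi s').
  move=> Is' Nphi Fphi lt_phi okpar.
  have le_phi : n <= Delta * (w - clock_width phi).
    by apply: leq_trans lt_n _; apply: le_mul; lia.
  have sub : normal phi -> round_inv (handle k loc (BoolQ phi) (Some par) s').
    move=> N; apply: IH => //; split=> //=; [lia|by right].
  move: Nphi sub; rewrite /issue.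
  by case: (phi) => [b _ _|? ?|? ?|?|? ?|? ?|? ? ?];
     [apply: resolve_inv => //; lia | move=> N; apply ..].
move: (emit (Query q) s2) I3 => s3 I3.
case: q {okq s1 I1 s2 I2 E2 okp le_n fresh kn} wfq le_q lt_n issue_inv q_gt0
  => [phi|[|x xs] vs phi] //= wfq le_q lt_n issue_inv q_gt0.
- have [N F] := wfq; case E: inst_leftmost => [[e psi]|].
    have [Fs _ _] := inst_leftmost_sub E; have W := clock_width_inst_leftmost E.
    have [Fs' _ _] := simplify_sub loc psi; have W' := clock_width_simplify loc psi.
    apply: issue_inv => //=; try lia.
      exact/simplify_truth_or_normal/inst_leftmost_ins_decided/E.
    by apply: subset_nil => y /Fs' /Fs; rewrite F.
  (* No quantifier is left: the width falls by the constant that this node eliminates. *)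
  case: eqP => // /eqP neq; have B := inst_leftmost_None E.
  have W := clock_width_simplify_lt N B F neq.
  have [Fs' _ _] := simplify_sub loc phi.
  apply: issue_inv => //=; try lia.
    exact/simplify_truth_or_normal/normal_ins_decided.
  by apply: subset_nil => y /Fs'; rewrite F.
- have [_ N F] := wfq.
  set phi' := simplify loc _.
  have N' : truth_or_normal phi'.
    apply: simplify_truth_or_normal; case: (phi) N => [b _|*|*|*|*|*|*] //;
      exact: subst_ins_decided.
  have W' : clock_width phi' <= clock_width phi.
    by rewrite -(clock_width_subst (last x xs) (own loc) phi); apply: clock_width_simplify.
  have F' : {subset free_vars phi' <= belast x xs}.
    have [S1 _ _] := simplify_sub loc (subst (last x xs) (Ins (own loc)) phi).
    have [S2 _ _] := subst_sub (last x xs) (own loc) phi.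
    move=> y /S1/S2; rewrite mem_filter => /andP[neq /F].
    by rewrite lastI mem_rcons inE (negbTE neq).
  have := size_belast x xs; case: (belast x xs) F' => [|y ys] F' Es.
    by apply: issue_inv => //=; [exact: subset_nil|lia].
  have le_w' : n <= Delta * (w - (size (y :: ys) + clock_width phi')).
    by apply: leq_trans lt_n _; apply: le_mul; lia.
  by apply: IH => //; split=> //=; rewrite /= in Es; [lia|right].
Qed.

(** In the first round every issue bound holds, so only the width matters. A sentence decided at
    once yields at most a result and no message. *)
Lemma pose_inv loc (r : fo_query U) s : net_diam loc = Delta -> n = 0 ->
  num_vars_consts r <= w -> round_inv s -> round_inv (pose loc r s).
Proof.
move=> Edelta n0 le_w I; rewrite /pose.
set phi := simplify loc _.
have N : truth_or_normal phi.
  exact/simplify_truth_or_normal/map_form_ins_decided.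
have W : clock_width phi <= size (bound_vars (qform r)) + size (undup (consts (qform r))).
  rewrite -csts_map_form -bound_vars_map_form; exact: clock_width_simplify.
have F : {subset free_vars phi <= qvars r}.
  have [S _ _] := simplify_sub loc (map_form (@Cst U) (qform r)).
  by move=> y /S; rewrite free_vars_map_form; apply: qvars_free.
move: le_w; rewrite /num_vars_consts; case: (qvars r) F => [|x xs] F le_w.
  have sub : normal phi -> round_inv (handle_query loc (BoolQ phi) (Some (PartQ [::] [::] phi)) s).
    move=> N'; apply: handle_inv => //; last by rewrite n0.
    split; [by split=> //; apply: subset_nil|rewrite /=; lia|by right; rewrite n0].
  by move: N sub; case: (phi) => [b _ _|? ?|? ?|?|? ?|? ?|? ? ?];
     [case: b => //=; apply: record_result_inv | move=> N; apply ..].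
apply: handle_inv => //; split=> //; last by right; rewrite n0.
by move: le_w => /=; lia.
Qed.

Lemma receive_query_inv loc s m : net_diam loc = Delta ->
  (forall q, m = Query q -> query_ok q) -> round_inv s -> round_inv (receive_query loc s m).
Proof.
move=> Edelta ok I; case: m ok => [q|*] //= ok; case: ifP => // _.
apply: handle_inv => //; first exact: ok.
by case: (q).
Qed.

(** The bound [k] is the default of the fold, so a smaller value is the hop count of a message
    actually received. *)
Lemma hops_in (k : nat) (inbox : seq (message U)) phi :
  hops k inbox phi < k -> exists b, Answer phi b (hops k inbox phi) \in inbox.
Proof.
elim: inbox => [|[q|psi b h] inbox IH] /=; first by rewrite ltnn.
  by move/IH => [b b_in]; exists b; rewrite inE b_in orbT.
case: eqP => [->|_]; last by move/IH => [b' b_in]; exists b'; rewrite inE b_in orbT.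
rewrite /minn; case: ifP => _ lt; first by exists b; rewrite mem_head.
by have [b' b_in] := IH lt; exists b'; rewrite inE b_in orbT.
Qed.

(** Forwarding raises both the round and the hop count by one, which keeps the inequality of
    [message_ok]. *)
Lemma receive_answer_inv loc inbox s m : net_diam loc = Delta ->
  (forall phi b h, Answer phi b h \in inbox -> n + Delta <= 2 * Delta * w + h) ->
  round_inv s -> round_inv (receive_answer loc inbox s m).
Proof.
move=> Edelta ok I; case: m => [q|phi b h] //=; case: ifP => // _.
apply: learn_inv; rewrite Edelta; case: ifP => // lt.
have [b' /ok le] := hops_in lt.
by apply: emit_answer_inv => //=; apply/andP; split=> //; lia.
Qed.

Lemma elapse_inv s : round_inv s -> round_inv (elapse s).
Proof.
move=> I; apply: foldl_closed => // s' phi _ Is'; case: leftmost => // e.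
exact: learn_inv.
Qed.

(** The invariant fixes [now], so it is claimed of the state just before the round counter
    advances. *)
Lemma round_inv_node_round loc req inbox s : net_diam loc = Delta ->
  (forall r, req = Some r -> n = 0 /\ num_vars_consts r <= w) ->
  (forall q, Query q \in inbox -> query_ok q) ->
  (forall phi b h, Answer phi b h \in inbox -> n + Delta <= 2 * Delta * w + h) ->
  round_inv (silent s) ->
  exists2 s', round_inv s' & node_round loc req inbox s =
    State (now s').+1 (qtable s') (clocks s') (answers s') (results s') (outbox s').
Proof.
move=> Edelta okr okq oka I; rewrite /node_round -/(silent s).
eexists; last by [].
apply: elapse_inv; apply: foldl_closed => [|s' m _]; last exact: receive_answer_inv.
apply: foldl_closed => [|s' m m_in].
  by case: req okr => // r /(_ r erefl)[n0 le_w]; apply: pose_inv.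
by apply: receive_query_inv => // q Em; apply: okq; rewrite -Em.
Qed.

End Round.

(** Classical, since distances and termination are given by arbitrary propositions. *)
Lemma ex_least (P : nat -> Prop) :
  (exists n, P n) -> exists2 n, P n & forall m, P m -> n <= m.
Proof.
case=> n; elim/ltn_ind: n => n IH Pn.
have [[m [Pm lt_m]]|no] := classic (exists m, P m /\ m < n); first exact: IH lt_m Pm.
by exists n => // m Pm; rewrite leqNgt; apply/negP => lt_m; apply: no; exists m.
Qed.

(** * Flooding and the invariant of the execution *)

Section Global.
Context (d : Order.disp_t) (U : orderType d) (D : nat) (G : network U D).
Context (Delta : nat) (hDelta : is_diameter G Delta) (r : U) (q0 : fo_query U).

Local Notation exec := (execution G Delta r q0).
Local Notation w := (num_vars_consts q0).

Lemma edge_nodes2 u v : edge G u v -> u \in nodes G /\ v \in nodes G.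
Proof.
by move=> e; split; [apply: edge_nodes e | rewrite edge_sym in e; apply: edge_nodes e].
Qed.

(** A shortest walk realizes the distance, which the diameter bounds. *)
Lemma short_path u v : u \in nodes G -> v \in nodes G ->
  exists p, [/\ path (edge G) u p, last u p = v & size p <= Delta].
Proof.
move=> u_in v_in; have [p0 P0 L0] := net_connected u_in v_in.
have [|k walk_k min_k] := @ex_least (walk G u v); first by exists (size p0), p0.
have le_k : k <= Delta by apply: hDelta.1 (conj walk_k min_k).
by have [p [P L Sp]] := walk_k; exists p; rewrite Sp.
Qed.

Lemma exec_mono t u v q : t <= u -> in_qtable (exec t v) q -> in_qtable (exec u v) q.
Proof.
move=> /subnKC <-; elim: (u - t) => [|k IH]; first by rewrite addn0.
move=> /IH in_k; rewrite addnS.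
exact: extends_in_qtable (node_round_extends _ _ _ _).1 in_k.
Qed.

(** A query in the table of [u] was there a round earlier, or [u] broadcast it in round [t] and [v]
    records it in the next one. *)
Lemma exec_flood1 t u v q : edge G u v -> in_qtable (exec t u) q ->
  in_qtable (exec t.+1 v) q.
Proof.
move=> e; elim: t => // t IH.
case: (node_round_extends (local_of G Delta u)
  (if (t == 0) && (u == r) then Some q0 else None)
  (flatten [seq outbox (exec t u') | u' <- neighbours G u]) (exec t u)) => [[_ _ new] _].
move/new => /orP[/IH|sent]; first exact: exec_mono.
apply: (node_round_extends _ _ _ _).2.
apply/flattenP; exists (outbox (exec t.+1 u)) => //; apply: map_f.
by rewrite mem_filter edge_sym e (edge_nodes2 e).1.
Qed.

Lemma exec_flood t u p q : path (edge G) u p -> in_qtable (exec t u) q ->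
  in_qtable (exec (t + size p) (last u p)) q.
Proof.
elim: p t u => [|v p IH] t u /=; first by rewrite addn0.
by move=> /andP[e P] /(exec_flood1 e); rewrite -addSnnS; apply: IH.
Qed.

(** The instance of [known] for the execution. A query issued after [m] completed rounds appears in
    the state after [m + 1], hence the successor. *)
Definition timely t q : Prop :=
  exists t0 u, [/\ t0 <= t, u \in nodes G, in_qtable (exec t0 u) q &
                   t0 <= (Delta * (w - query_width q)).+1].

Record exec_inv t v : Prop := ExecInv {
  exec_now : now (exec t v) = t;
  exec_qtable : forall e, e \in qtable (exec t v) ->
    [/\ wf_query e.1, query_width e.1 <= w, timely t e.1 & parent_ok w e.1 e.2];
  exec_clocks : forall c, c \in clocks (exec t v) -> c.2 <= Delta * (w + clock_width c.1);
  exec_queries : forall q, Query q \in outbox (exec t v) ->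
    t <= 2 * Delta * w /\ in_qtable (exec t v) q;
  exec_answers : forall phi b h, Answer phi b h \in outbox (exec t v) ->
    t + Delta <= 2 * Delta * w + h /\ h <= Delta
}.

Context (Delta_gt0 : 0 < Delta).

Lemma exec_invP t v : v \in nodes G -> exec_inv t v.
Proof.
elim: t v => [|t IH] v v_in; first by split.
(* Otherwise the early record at [t0] and a path of length at most [Delta] would have brought the
   query to [v] by round [t]. *)
have flooded q : timely t q -> ~ in_qtable (exec t v) q ->
    t <= Delta * (w - query_width q).+1.
  move=> [t0 [u [le_t u_in q_in le_t0]]] no.
  have [p [P L le_p]] := short_path u_in v_in.
  have := exec_flood P q_in; rewrite L => in_v.
  rewrite leqNgt; apply/negP => lt; apply: no; apply: exec_mono in_v.
  by move: lt; rewrite mulnS; lia.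
have [I1 I2 I3 I4 I5] := IH v v_in.
have [|||||s' [J1 J2 J3 J4 J5 J6] E] := @round_inv_node_round U Delta w t
  (in_qtable (exec t v)) (timely t) Delta_gt0 flooded (local_of G Delta v)
  (if (t == 0) && (v == r) then Some q0 else None)
  (flatten [seq outbox (exec t u) | u <- neighbours G v]) (exec t v).
- by [].
- by case: eqP => //= -> r' ; case: ifP => // _ [<-].
- move=> q /flattenP[_ /mapP[u u_nb ->] sent].
  have u_in : u \in nodes G by move: u_nb; rewrite mem_filter => /andP[].
  have [_ /mapP[e e_in ->]] := exec_queries (IH u u_in) sent.
  by have [? ? ? _] := exec_qtable (IH u u_in) e_in; split=> //; left.
- move=> phi b h /flattenP[_ /mapP[u u_nb ->] sent].
  have u_in : u \in nodes G by move: u_nb; rewrite mem_filter => /andP[].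
  by have [] := exec_answers (IH u u_in) sent.
- split=> //= e e_in; have [? ? ? ?] := I2 e e_in.
  by split=> //; split=> //; left.
have Ee : exec t.+1 v = State (now s').+1 (qtable s') (clocks s') (answers s')
    (results s') (outbox s') by exact: E.
split; rewrite Ee /= ?J1 //.
- move=> e e_in; have [[wfe le_e kn] okp] := J3 e e_in; split=> //.
  case: kn => [[t0 [u [le_t u_in q_in le_t0]]]|le].
    by exists t0, u; split=> //; apply: leqW.
  (* A query within its issue bound is witnessed by this node and this round. *)
  exists t.+1, v; split=> //; rewrite Ee; exact: map_f.
- by move=> q sent; split; [exact: (J5 _ sent)|exact: J6].
- move=> phi b h /J5 /andP[]; lia.
Qed.

Lemma message_sent_le t : message_sent G Delta r q0 t -> t <= 2 * Delta * w.
Proof.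
move=> [u [v [u_in e]]]; have := exec_invP t u_in; case Eo: (outbox _) => [//|m l] I _.
have : m \in outbox (exec t u) by rewrite Eo mem_head.
case: m Eo => [q|phi b h] _; first by case/(exec_queries I).
by case/(exec_answers I); lia.
Qed.

End Global.

(** * The bound on the distributed time *)

Theorem theorem1 (d : Order.disp_t) (U : orderType d) (Uinf : infinite_set U)
    (D : nat) (G : network U D) (Delta : nat) (hDelta : is_diameter G Delta)
    (r : U) (hr : r \in nodes G) (psi : fo_query U) :
  exists T : nat, is_distributed_time G Delta r psi T /\
    T <= 2 * Delta * num_vars_consts psi.
Proof.
have term : terminated_after G Delta r psi (2 * Delta * num_vars_consts psi).
  move=> t lt_t sent; suff : t <= 2 * Delta * num_vars_consts psi by lia.
  apply: (message_sent_le hDelta _ sent).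
  (* Sending along an edge requires two distinct nodes, so [Delta] is positive. *)
  have [u [v [_ e _]]] := sent; have [u_in v_in] := edge_nodes2 e.
  have [p [_ L le_p]] := short_path hDelta u_in v_in.
  case: p L le_p => [|x p] /= L; last by lia.
  by rewrite L edge_irr in e.
have [|T termT minT] := @ex_least (terminated_after G Delta r psi); first by eexists; exact: term.
by exists T; split; [split|apply: minT].
Qed.
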